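(* Let $1<p<\infty$ and let $K\in L^1(\mathbb{T}^\infty)$ be a nonnegative function with $\log K\in L^1(\mathbb{T}^\infty)$ and $\|K\|_1=1$. Put $$S(K)=\inf_{q\in\mathcal{P}_0}\int_{\mathbb{T}^\infty}|1-q|^pK\,dm_\infty .$$ Then $S(K)=1$ if and only if $$\hat K(\alpha)=\hat K(-\alpha)=0\quad\text{for all } 0\neq\alpha\in\mathbb{N}_0^\infty,$$ where $\mathbb{N}_0^\infty$ is the set of all finitely supported sequences of nonnegative integers.
   Context: $\mathbb{T}^\infty$ is the countably infinite product of unit circles, with Haar probability measure $m_\infty$. $\mathcal{P}_\infty$ is the ring of analytic polynomials, each depending on finitely many of the complex variables $\zeta_1,\zeta_2,\ldots$, and $\mathcal{P}_0=\{q\in\mathcal{P}_\infty:q(0)=0\}$. For a finitely supported sequence of integers $\alpha$, the Fourier coefficient is $\hat K(\alpha)=\int_{\mathbb{T}^\infty}K\,\overline{e_\alpha}\,dm_\infty$, where $e_\alpha(w)=w_1^{\alpha_1}w_2^{\alpha_2}\cdots$, $w\in\mathbb{T}^\infty$. *)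

(* Defs.v *)
From HB Require Import structures.
From mathcomp Require Import all_boot all_order all_algebra finmap.
From mathcomp Require Import complex.
(* Not imported: the notations of mpoly clash with those of mathcomp-analysis. *)
From mathcomp Require mpoly.
From mathcomp Require Import all_classical all_reals all_analysis.
Set Implicit Arguments.
Unset Strict Implicit.
Unset Printing Implicit Defensive.
Import Order.TTheory GRing.Theory Num.Theory.
Import numFieldTopology.Exports numFieldNormedType.Exports.

Local Open Scope classical_set_scope.
Local Open Scope ring_scope.
Local Open Scope complex_scope.

(* [set_type] carries the topology induced by R[i]. *)
Definition circle (R : realType) : Type :=
  set_type [set z : R[i]^o | `|z| = 1 :> R[i]].
HB.instance Definition _ (R : realType) := Topological.on (circle R).

Definition circle_val (R : realType) (z : circle R) : R[i] := \val z.

Lemma circle_val_norm (R : realType) (z : circle R) : `|circle_val z| = 1.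
Proof. by case: z => z zP; exact: (set_mem zP). Qed.

Definition circle_one (R : realType) : circle R :=
  exist _ (1 : R[i]^o) (mem_set (normr1 R[i])).
HB.instance Definition _ (R : realType) :=
  isPointed.Build (circle R) (circle_one R).

Lemma circle_mul_subproof (R : realType) (z w : circle R) :
  `|circle_val z * circle_val w| = 1.
Proof. by rewrite normrM !circle_val_norm mulr1. Qed.

Definition circle_mul (R : realType) (z w : circle R) : circle R :=
  exist _ (circle_val z * circle_val w : R[i]^o)
    (mem_set (circle_mul_subproof z w)).

(* Coordinates are numbered from 0: the variable zeta_j is coordinate j - 1. *)
Definition torus (R : realType) : Type :=
  prod_topology (fun _ : nat => circle R).
HB.instance Definition _ (R : realType) := Topological.on (torus R).
HB.instance Definition _ (R : realType) :=
  isPointed.Build (torus R) (fun _ => circle_one R).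

Definition torus_mul (R : realType) (u w : torus R) : torus R :=
  fun j => circle_mul (u j) (w j).

Definition borel_torus (R : realType) :=
  g_sigma_algebraType (@open (torus R)).

(* Translation-invariant Borel probability measure. Every finite Borel measure
   on this compact metrizable group is regular, so these conditions
   characterize m_infty. *)
Definition is_haar (R : realType) (m : probability (borel_torus R) R) : Prop :=
  forall (u : torus R) (A : set (borel_torus R)), measurable A ->
    m (torus_mul u @^-1` A) = m A.

Definition Cintegral (R : realType) (m : probability (borel_torus R) R)
    (f : borel_torus R -> R[i]) : R[i] :=
  (\int[m]_w complex.Re (f w))%R +i* (\int[m]_w complex.Im (f w))%R.

Definition multi_index := {fsfun nat -> int with 0}.

Fact opp_multi_index_key : unit. Proof. exact: tt. Qed.
Definition opp_multi_index (a : multi_index) : multi_index :=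
  [fsfun[opp_multi_index_key] j in finsupp a => - a j | 0].

Lemma opp_multi_indexE (a : multi_index) j : opp_multi_index a j = - a j.
Proof.
rewrite /opp_multi_index fsfunE; case: ifPn => // ja.
by rewrite fsfun_dflt // oppr0.
Qed.

Definition zero_multi_index : multi_index := [fsfun].

Definition nonneg_multi_index (a : multi_index) : Prop := forall j, 0 <= a j.

Definition torus_char (R : realType) (a : multi_index) (w : torus R) : R[i] :=
  \prod_(j <- finsupp a) circle_val (w j) ^ a j.

Definition fourier (R : realType) (m : probability (borel_torus R) R)
    (K : borel_torus R -> R) (a : multi_index) : R[i] :=
  Cintegral m (fun w => (K w)%:C * (torus_char a w)^*).

(* Polynomials in zeta_1, ..., zeta_n, for all n, as functions on the torus. *)
Definition poly_torus (R : realType) (n : nat) (q : mpoly.mpoly n R[i])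
    (w : torus R) : R[i] :=
  mpoly.meval (fun j : 'I_n => circle_val (w j)) q.

Definition P0 (R : realType) : set (torus R -> R[i]) :=
  [set f | exists (n : nat) (q : mpoly.mpoly n R[i]),
     mpoly.meval (fun _ => 0) q = 0 /\ f = poly_torus q].

Definition szego_inf (R : realType) (m : probability (borel_torus R) R)
    (p : R) (K : borel_torus R -> R) : \bar R :=
  ereal_inf [set (\int[m]_w ((ComplexField.Normc.normc (1 - q w) `^ p * K w)%:E))%E
            | q in @P0 R].

(* Main.v *)
Require Import Defs.
From mathcomp Require Import all_boot all_order all_algebra finmap.
From mathcomp Require Import complex.
From mathcomp Require Import all_classical all_reals all_analysis.
From mathcomp Require Import measurable_realfun.
From mathcomp Require Import ring lra.
From mathcomp Require mpoly.
Import (coercions, canonicals) mpoly.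
Import Order.TTheory GRing.Theory Num.Theory.
Import numFieldTopology.Exports numFieldNormedType.Exports.
Import ComplexField.Normc.
Set Implicit Arguments.
Unset Strict Implicit.
Local Open Scope classical_set_scope.
Local Open Scope ring_scope.
Local Open Scope complex_scope.

(** The point q = 0 is admissible in the infimum and gives the value ||K||_1 = 1,
so the claim is that q = 0 is a minimiser exactly when the weighted integral of
every e_a with a nonnegative and nonzero vanishes; this is the first-order
condition of a convex minimisation problem over the vector space P_0.

Sufficiency of the condition is convexity.  The tangent inequality
|z|^p >= 1 + p (Re z - 1) ([powR_normc_ge]), integrated against K at z = 1 - q,
gives a lower bound of 1 as soon as the K-integral of q vanishes
([powR_mean_ge]), and q is a linear combination of characters e_a with a
nonnegative and nonzero.

Necessity is a first variation.  The function |.|^p is smooth near 1, so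
|1 - t f|^p <= 1 - p t Re f + C t^2 for bounded f and small t >= 0
([powR_normc_1sub_le]).  If 0 is a minimiser along the ray
spanned by f, then p t Re (int f K) <= C t^2, hence Re (int f K) <= 0
([Re_mean_le0]).  For f = conj(z) e_a with z = int e_a K this reads |z|^2 <= 0.

The number int e_a K is the Fourier coefficient of K at -a, and the one at a is
its conjugate because K is real; this links the integrals with the two families
of coefficients. *)

(** * Pointwise estimates for powers of the modulus *)

Section PowerEstimates.
Variable R : realType.
Implicit Types (z : R[i]) (p t x : R).

Lemma normc_ge0 z : 0 <= normc z.
Proof. by case: z => a b; exact: sqrtr_ge0. Qed.

Lemma sqr_normcE z : normc z ^+ 2 = complex.Re z ^+ 2 + complex.Im z ^+ 2.
Proof. by case: z => a b /=; rewrite sqr_sqrtr// addr_ge0 ?sqr_ge0. Qed.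

Lemma le_normr_Re z : `|complex.Re z| <= normc z.
Proof.
rewrite -(ler_pXn2r (n := 2))// ?nnegrE ?normc_ge0// sqr_normcE real_normK ?num_real//.
by rewrite lerDl sqr_ge0.
Qed.

Lemma le_normr_Im z : `|complex.Im z| <= normc z.
Proof.
rewrite -(ler_pXn2r (n := 2))// ?nnegrE ?normc_ge0// sqr_normcE real_normK ?num_real//.
by rewrite lerDr sqr_ge0.
Qed.

(** Bernoulli's inequality with a real exponent.  With x = exp l it follows from
two instances of exp u >= 1 + u: one at (p - 1) l and one at - l. *)
Lemma powR_ge_tangent p x : 1 <= p -> 0 <= x -> 1 + p * (x - 1) <= x `^ p.
Proof.
move=> p1; rewrite le_eqVlt => /predU1P[<-|x0].
  by rewrite powR0; lra.
rewrite /powR gt_eqF//; set l := ln x.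
have xE : x = expR l by rewrite /l lnK.
have h1 : (p - 1) * l <= expR ((p - 1) * l) - 1.
  by have := expR_ge1Dx ((p - 1) * l); lra.
have h2 : x - 1 <= x * l.
  have := ler_wpM2l (ltW x0) (expR_ge1Dx (- l)).
  by rewrite {2}xE -expRD subrr expR0; lra.
have -> : expR (p * l) = x * expR ((p - 1) * l).
  by rewrite {1}xE -expRD; congr expR; ring.
have := ler_wpM2l (ltW x0) h1.
have : (p - 1) * (x - 1) <= (p - 1) * (x * l) by rewrite ler_wpM2l// subr_ge0.
lra.
Qed.

Lemma powR_normc_ge p z : 1 <= p ->
  1 + p * (complex.Re z - 1) <= normc z `^ p.
Proof.
move=> p1; apply: le_trans (powR_ge_tangent p1 (normc_ge0 z)).
rewrite lerD2l ler_wpM2l//; first lra.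
by rewrite lerD2r (le_trans (ler_norm _)) ?le_normr_Re.
Qed.

(** Inverting exp (- x) >= 1 - x gives exp x <= 1 / (1 - x), and for x <= 1/2 the
latter is at most the quadratic polynomial. *)
Lemma expR_le_quadratic x : x <= 2^-1 -> expR x <= 1 + x + 2 * x ^+ 2.
Proof.
move=> x2.
have h : 1 - x <= expR (- x) by have := expR_ge1Dx (- x); lra.
have q0 : 0 <= 1 + x + 2 * x ^+ 2 by have := sqr_ge0 (x + 2^-1); nra.
rewrite -(ler_pM2r (expR_gt0 (- x))) -expRD subrr expR0.
apply: le_trans (ler_wpM2l q0 h).
have := sqr_ge0 x; nra.
Qed.

(** Replaces the power by a function of x ^ 2, which for a modulus is polynomial
in the coordinates; it comes from ln y <= y - 1 at y = x ^ 2. *)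
Lemma powR_le_expR p x : 0 < p -> 0 <= x ->
  x `^ p <= expR (p / 2 * (x ^+ 2 - 1)).
Proof.
move=> p0; rewrite le_eqVlt => /predU1P[<-|x0].
  by rewrite powR0 ?expR_ge0// gt_eqF.
rewrite /powR gt_eqF// ler_expR -mulrA ler_pM2l//.
have : ln (1 + (x ^+ 2 - 1)) <= x ^+ 2 - 1.
  by apply: le_ln1Dx; have := exprn_gt0 2 x0; lra.
rewrite addrC subrK lnXn// mulr2n; lra.
Qed.

(** A second-order upper Taylor estimate.  The exponent supplied by
[powR_le_expR] is p / 2 * s with s = |1 - t z|^2 - 1 = - 2 t Re z + t^2 |z|^2,
and |s| <= t (2 M + M^2); the smallness condition on t keeps the exponent in the
range of [expR_le_quadratic]. *)
Lemma powR_normc_1sub_le p M z t : 0 < p -> 0 <= t <= 1 -> normc z <= M ->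
  t * (p * (2 * M + M ^+ 2)) <= 1 ->
  normc (1 - t%:C * z) `^ p <=
    1 - p * t * complex.Re z +
    t ^+ 2 * (p / 2 * M ^+ 2 + p ^+ 2 / 2 * (2 * M + M ^+ 2) ^+ 2).
Proof.
move=> p0 /andP[t0 t1] zM tB.
set r := complex.Re z; set n := normc z ^+ 2; set B := 2 * M + M ^+ 2.
have n0 := normc_ge0 z.
have sE : normc (1 - t%:C * z) ^+ 2 - 1 = - (2 * t * r) + t ^+ 2 * n.
  rewrite /n /r !sqr_normcE; case: z {zM n n0 r} => a b /=; ring.
apply: le_trans (powR_le_expR p0 (normc_ge0 _)) _; rewrite sE.
set s := _ + _.
have nM : n <= M ^+ 2 by rewrite lerXn2r// nnegrE (le_trans n0).
have nn : 0 <= n by rewrite exprn_ge0.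
have rM : `|r| <= M by apply: le_trans zM; exact: le_normr_Re.
move: rM; rewrite ler_norml => /andP[rM1 rM2].
have tt : t ^+ 2 <= t by rewrite expr2 ler_piMr.
have sB : `|s| <= t * B.
  rewrite ler_norml /s /B; apply/andP; split.
    have : 0 <= t ^+ 2 * n by rewrite mulr_ge0// sqr_ge0.
    have : t * r <= t * M by rewrite ler_wpM2l.
    have : 0 <= t * M ^+ 2 by rewrite mulr_ge0// sqr_ge0.
    lra.
  have : t ^+ 2 * n <= t * M ^+ 2 by rewrite ler_pM// sqr_ge0.
  have : t * - M <= t * r by rewrite ler_wpM2l.
  lra.
have s2 : s ^+ 2 <= (t * B) ^+ 2.
  by rewrite -(real_normK (num_real s)) lerXn2r ?nnegrE// (le_trans _ sB).
apply: le_trans (expR_le_quadratic _) _.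
  have : p * s <= p * (t * B).
    by rewrite ler_pM2l// (le_trans (ler_norm _)).
  rewrite -/B in tB; lra.
have : (p ^+ 2 / 2) * s ^+ 2 <= (p ^+ 2 / 2) * (t * B) ^+ 2.
  by rewrite ler_wpM2l// mulr_ge0// ?sqr_ge0.
have : (p / 2 * t ^+ 2) * n <= (p / 2 * t ^+ 2) * M ^+ 2.
  by rewrite ler_wpM2l// mulr_ge0// ?sqr_ge0// divr_ge0// ltW.
have -> : (p / 2 * s) ^+ 2 = p ^+ 2 / 4 * s ^+ 2 by field.
have -> : p / 2 * s = - (p * t * r) + (p / 2 * t ^+ 2) * n by rewrite /s; field.
rewrite exprMn -/B; lra.
Qed.
End PowerEstimates.

(** * Bounded measurable complex functions and their weighted means *)

Section WeightedMean.
Context d (T : measurableType d) (R : realType).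
Variable mu : {measure set T -> \bar R}.
Variable K : T -> R.
Hypothesis K_L1 : mu.-integrable setT (EFin \o K).
Implicit Types (f g : T -> R[i]) (h k : T -> R).

Definition bounded_mfun f : Prop :=
  [/\ measurable_fun setT (fun w => complex.Re (f w)),
      measurable_fun setT (fun w => complex.Im (f w)) &
      exists M, forall w, normc (f w) <= M].

Definition wmean f : R[i] :=
  (\int[mu]_w (complex.Re (f w) * K w))%R +i*
  (\int[mu]_w (complex.Im (f w) * K w))%R.

Lemma bounded_mfun_cst c : bounded_mfun (fun=> c).
Proof.
by split; [exact: measurable_cst | exact: measurable_cst | exists (normc c)].
Qed.

Lemma bounded_mfunD f g :
  bounded_mfun f -> bounded_mfun g -> bounded_mfun (fun w => f w + g w).
Proof.
move=> [fr fi [M fM]] [gr gi [N gN]]; split.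
- under eq_fun do rewrite raddfD; exact: measurable_funD.
- under eq_fun do rewrite raddfD; exact: measurable_funD.
- by exists (M + N) => w; apply: le_trans (le_normcD _ _) _; exact: lerD.
Qed.

Lemma bounded_mfunM f g :
  bounded_mfun f -> bounded_mfun g -> bounded_mfun (fun w => f w * g w).
Proof.
move=> [fr fi [M fM]] [gr gi [N gN]]; split.
- rewrite (_ : (fun w => _) = fun w => complex.Re (f w) * complex.Re (g w)
    - complex.Im (f w) * complex.Im (g w)).
    by apply: measurable_funB; exact: measurable_funM.
  by apply/funext => w; case: (f w) (g w) => a b [].
- rewrite (_ : (fun w => _) = fun w => complex.Re (f w) * complex.Im (g w)
    + complex.Im (f w) * complex.Re (g w)).
    by apply: measurable_funD; exact: measurable_funM.
  by apply/funext => w; case: (f w) (g w) => a b [].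
- by exists (M * N) => w; rewrite normcM; apply: ler_pM => //; exact: normc_ge0.
Qed.

Lemma bounded_mfun_1sub f : bounded_mfun f -> bounded_mfun (fun w => 1 - f w).
Proof.
move=> bf; apply: bounded_mfunD; first exact: bounded_mfun_cst.
under eq_fun do rewrite -mulN1r.
by apply: bounded_mfunM => //; exact: bounded_mfun_cst.
Qed.

Lemma bounded_mfun_prod (I : Type) (r : seq I) (F : I -> T -> R[i]) :
  (forall i, bounded_mfun (F i)) ->
  bounded_mfun (fun w => \prod_(i <- r) F i w).
Proof.
move=> bF; elim: r => [|i r IH].
  by under eq_fun do rewrite big_nil; exact: bounded_mfun_cst.
by under eq_fun do rewrite big_cons; exact: bounded_mfunM.
Qed.

Lemma bounded_mfun_sum (I : Type) (r : seq I) (F : I -> T -> R[i]) :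
  (forall i, bounded_mfun (F i)) ->
  bounded_mfun (fun w => \sum_(i <- r) F i w).
Proof.
move=> bF; elim: r => [|i r IH].
  by under eq_fun do rewrite big_nil; exact: bounded_mfun_cst.
by under eq_fun do rewrite big_cons; exact: bounded_mfunD.
Qed.

Lemma bounded_mfunX f n : bounded_mfun f -> bounded_mfun (fun w => f w ^+ n).
Proof.
move=> bf; elim: n => [|n IH].
  by under eq_fun do rewrite expr0; exact: bounded_mfun_cst.
by under eq_fun do rewrite exprS; exact: bounded_mfunM.
Qed.

Lemma integrable_bounded_mul h M : measurable_fun setT h ->
  (forall w, `|h w| <= M) -> mu.-integrable setT (EFin \o (fun w => h w * K w)).
Proof.
move=> mh hM; apply: (integrableMr measurableT mh _ K_L1).
exists M; split; first exact: num_real.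
by move=> N MN w _ /=; rewrite (le_trans (hM w)) ?ltW.
Qed.

Lemma integrable_Re f : bounded_mfun f ->
  mu.-integrable setT (EFin \o (fun w => complex.Re (f w) * K w)).
Proof.
move=> [mf _ [M fM]]; apply: (integrable_bounded_mul mf (M := M)) => w.
exact: le_trans (le_normr_Re _) (fM w).
Qed.

Lemma integrable_Im f : bounded_mfun f ->
  mu.-integrable setT (EFin \o (fun w => complex.Im (f w) * K w)).
Proof.
move=> [_ mf [M fM]]; apply: (integrable_bounded_mul mf (M := M)) => w.
exact: le_trans (le_normr_Im _) (fM w).
Qed.

Lemma measurable_normc f : bounded_mfun f ->
  measurable_fun setT (fun w => normc (f w)).
Proof.
move=> [mr mi _].
rewrite (_ : (fun w => _) = fun w =>
  (complex.Re (f w) ^+ 2 + complex.Im (f w) ^+ 2) `^ 2^-1).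
  apply: (measurableT_comp (measurable_powR 2^-1)).
  by apply: measurable_funD; exact: measurable_funX.
apply/funext => w; rewrite powR12_sqrt ?addr_ge0 ?sqr_ge0//.
by case: (f w).
Qed.

Lemma integrable_powR_normc p f : 0 <= p -> bounded_mfun f ->
  mu.-integrable setT (EFin \o (fun w => normc (f w) `^ p * K w)).
Proof.
move=> p0 bf; have [_ _ [M fM]] := bf.
apply: (integrable_bounded_mul (M := M `^ p)).
  exact: (measurableT_comp (measurable_powR p)) (measurable_normc bf).
move=> w; rewrite ger0_norm ?powR_ge0// ge0_ler_powR ?nnegrE ?normc_ge0//.
exact: le_trans (normc_ge0 _) (fM w).
Qed.

Lemma wmeanD f g : bounded_mfun f -> bounded_mfun g ->
  wmean (fun w => f w + g w) = wmean f + wmean g.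
Proof.
move=> bf bg; rewrite /wmean; simpc; congr (_ +i* _).
  rewrite -RintegralD//; [|exact: integrable_Re..].
  by apply: eq_Rintegral => w _; rewrite raddfD mulrDl.
rewrite -RintegralD//; [|exact: integrable_Im..].
by apply: eq_Rintegral => w _; rewrite raddfD mulrDl.
Qed.

Lemma wmeanZ c f : bounded_mfun f ->
  wmean (fun w => c * f w) = c * wmean f.
Proof.
move=> bf; case: c => a b; rewrite /wmean; simpc.
rewrite -!RintegralZl//; [|exact: integrable_Re|exact: integrable_Im..|exact: integrable_Re].
have iR c := integrable_Re (bounded_mfunM (bounded_mfun_cst (c%:C)) bf).
have iI c := integrable_Im (bounded_mfunM (bounded_mfun_cst (c%:C)) bf).
have ReE c w : complex.Re (c%:C * f w) = c * complex.Re (f w).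
  by case: (f w) => x y /=; ring.
have ImE c w : complex.Im (c%:C * f w) = c * complex.Im (f w).
  by case: (f w) => x y /=; ring.
have iR' c : mu.-integrable setT (EFin \o (fun w => c * (complex.Re (f w) * K w))).
  by have := iR c; congr (_.-integrable _ _); apply/funext => w /=; rewrite ReE mulrA.
have iI' c : mu.-integrable setT (EFin \o (fun w => c * (complex.Im (f w) * K w))).
  by have := iI c; congr (_.-integrable _ _); apply/funext => w /=; rewrite ImE mulrA.
congr (_ +i* _).
  rewrite -RintegralB//; apply: eq_Rintegral => w _.
  by case: (f w) => x y /=; ring.
rewrite -RintegralD//; apply: eq_Rintegral => w _.
by case: (f w) => x y /=; ring.
Qed.

Lemma wmean_sum (I : Type) (r : seq I) (F : I -> T -> R[i]) :
  (forall i, bounded_mfun (F i)) ->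
  wmean (fun w => \sum_(i <- r) F i w) = \sum_(i <- r) wmean (F i).
Proof.
move=> bF; elim: r => [|i r IH].
  rewrite big_nil /wmean.
  under eq_Rintegral do rewrite big_nil mul0r.
  under [X in _ +i* X]eq_Rintegral do rewrite big_nil mul0r.
  by rewrite Rintegral_cst// mul0r.
rewrite big_cons -IH -wmeanD//; last exact: bounded_mfun_sum.
by congr wmean; apply/funext => w; rewrite big_cons.
Qed.

Lemma le_Rintegral_ae h k : mu.-integrable setT (EFin \o h) ->
  mu.-integrable setT (EFin \o k) -> {ae mu, forall w, h w <= k w} ->
  \int[mu]_w h w <= \int[mu]_w k w.
Proof.
move=> ih ik hk.
rewrite -subr_ge0 -RintegralB//.
have mkh : measurable_fun setT (fun w => k w - h w).
  apply: measurable_funB; apply/measurable_EFinP.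
    exact: measurable_int ik.
  exact: measurable_int ih.
(* The positive part of k - h agrees with k - h almost everywhere. *)
rewrite /Rintegral (ae_eq_integral (fun w => (Num.max (k w - h w) 0)%:E))//.
- by apply: fine_ge0; apply: integral_ge0 => w _; rewrite lee_fin le_max lexx orbT.
- exact/measurable_EFinP.
- by apply/measurable_EFinP; apply: measurable_maxr => //; exact: measurable_cst.
- apply: filterS hk => w hkw _; congr EFin.
  by apply/esym/max_idPl; rewrite subr_ge0.
Qed.

Hypothesis K_ge0 : {ae mu, forall w, 0 <= K w}.

(** The convexity half: the tangent inequality at z = 1 - f, multiplied by K and
integrated, leaves only the integral of K because the linear term drops out. *)
Lemma powR_mean_ge p f : 1 <= p -> bounded_mfun f ->
  complex.Re (wmean f) = 0 ->
  \int[mu]_w K w <= \int[mu]_w (normc (1 - f w) `^ p * K w).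
Proof.
move=> p1 bf f0.
have iK : mu.-integrable setT (EFin \o (fun w => (- p) * (complex.Re (f w) * K w))).
  have := integrableZl measurableT (- p) (integrable_Re bf).
  by apply: eq_integrable.
have -> : \int[mu]_w K w =
    \int[mu]_w (K w + (- p) * (complex.Re (f w) * K w)).
  rewrite RintegralD// RintegralZl//; last exact: integrable_Re.
  by move: f0 => /= ->; rewrite mulr0 addr0.
have b1f := bounded_mfun_1sub bf.
apply: le_Rintegral_ae.
- have := integrableD measurableT K_L1 iK.
  by apply: eq_integrable.
- by apply: integrable_powR_normc => //; lra.
- apply: filterS K_ge0 => w Kw.
  have := ler_wpM2r Kw (powR_normc_ge (1 - f w) p1).
  by case: (f w) => a b /=; lra.
Qed.

(** The first-variation half: along the ray t f the value at t = 0 is minimal, so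
the derivative at 0, which is - p Re (int f K), is nonnegative. *)
Lemma Re_mean_le0 p f : 0 < p -> bounded_mfun f ->
  (forall t : R, 0 <= t -> \int[mu]_w K w <=
     \int[mu]_w (normc (1 - t%:C * f w) `^ p * K w)) ->
  complex.Re (wmean f) <= 0.
Proof.
move=> p0 bf hmin; have [_ _ [M fM]] := bf.
set C := p / 2 * M ^+ 2 + p ^+ 2 / 2 * (2 * M + M ^+ 2) ^+ 2.
set I := \int[mu]_w K w; set z := complex.Re (wmean f).
set B := p * (2 * M + M ^+ 2).
have M0 : 0 <= M by apply: le_trans (normc_ge0 _) (fM point).
have B0 : 0 <= B.
  by apply: mulr_ge0; [exact: ltW | apply: addr_ge0; [exact: mulr_ge0 | exact: sqr_ge0]].
have key t : 0 <= t <= 1 -> t * B <= 1 -> p * t * z <= t ^+ 2 * (C * I).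
  move=> t01 tB; have /andP[t0 _] := t01.
  have ir := integrableZl measurableT (- (p * t)) (integrable_Re bf).
  have iC := integrableZl measurableT (t ^+ 2 * C) K_L1.
  have b1f : bounded_mfun (fun w => 1 - t%:C * f w).
    apply: bounded_mfun_1sub.
    by apply: bounded_mfunM => //; exact: bounded_mfun_cst.
  have : I <= \int[mu]_w (K w +
      (- (p * t) * (complex.Re (f w) * K w) + t ^+ 2 * C * K w)).
    apply: le_trans (hmin t t0) _; apply: le_Rintegral_ae.
    - by apply: integrable_powR_normc => //; exact: ltW.
    - have := integrableD measurableT K_L1 (integrableD measurableT ir iC).
      exact: eq_integrable.
    - apply: filterS K_ge0 => w Kw.
      have := ler_wpM2r Kw (powR_normc_1sub_le p0 t01 (fM w) tB).
      rewrite -/C; lra.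
  rewrite RintegralD//; last first.
    by have := integrableD measurableT ir iC; exact: eq_integrable.
  rewrite RintegralD// !RintegralZl//; last exact: integrable_Re.
  rewrite -/I -[\int[mu]_w (complex.Re _ * _)]/z; lra.
rewrite leNgt; apply/negP => z0.
(* t = 1 / D is small enough for the estimate and contradicts it. *)
set D := B + 1 + `|C * I| / (p * z).
have pz : 0 < p * z by rewrite mulr_gt0.
have X0 : 0 <= `|C * I| / (p * z) by rewrite divr_ge0// ltW.
have D1 : 1 <= D by rewrite /D; lra.
have DB : B <= D by rewrite /D; lra.
have D0 : 0 < D by lra.
have CD : C * I < p * z * D.
  rewrite /D mulrDr mulrCA divff ?gt_eqF// mulr1.
  have := ler_norm (C * I).
  have : 0 <= p * z * B by rewrite mulr_ge0// ltW.
  lra.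
have := key D^-1; rewrite invr_ge0 (ltW D0) invf_le1// D1 => /(_ isT).
rewrite mulrC ler_pdivrMr// mul1r.
move=> /(_ DB).
rewrite -(ler_pM2r D0) -(ler_pM2r D0).
have -> : p * D^-1 * z * D * D = p * z * D by field; rewrite gt_eqF.
have -> : D^-1 ^+ 2 * (C * I) * D * D = C * I by field; rewrite gt_eqF.
lra.
Qed.

End WeightedMean.

(** * Characters and polynomials on the torus *)

Section Torus.
Variable R : realType.
Implicit Types (a : multi_index) (w : torus R).

Lemma continuous_contracting_additive (g : {additive R[i] -> R}) :
  (forall z, `|g z| <= normc z) -> continuous (g : R[i]^o -> R^o).
Proof.
move=> gz z A /nbhs_normP[e /= e0 eA]; exists e%:C; first by rewrite /= ltcR.
move=> y /=; rewrite normc_def ltcR => zy; apply: eA; rewrite /= -raddfB.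
by apply: le_lt_trans zy; rewrite (le_trans (gz _))//; case: (_ - _).
Qed.

Lemma continuous_coord j :
  continuous (fun w : torus R => circle_val (w j) : R[i]^o).
Proof.
move=> w; apply: (@continuous_comp _ _ _ (fun w : torus R => w j)
  (@circle_val R : circle R -> R[i]^o)).
  exact: (@proj_continuous nat (fun=> circle R) j).
exact: initial_continuous.
Qed.

Lemma continuous_borel_torus (f : torus R -> R^o) : continuous f ->
  measurable_fun setT (f : borel_torus R -> R).
Proof.
move=> /continuousP cf; apply: (measurability _ (RGenOpens.measurableE R)).
move=> _ [_ [a [b ->] <-]]; rewrite setTI.
by apply: sub_sigma_algebra; apply: cf; exact: interval_open.
Qed.

Lemma bounded_mfun_coord j :
  bounded_mfun (fun w : borel_torus R => circle_val (w j)).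
Proof.
split.
- apply: (@continuous_borel_torus (fun w => complex.Re (circle_val (w j)))) => w.
  have := @continuous_comp _ _ _ (fun w : torus R => circle_val (w j) : R[i]^o)
    (@complex.Re R : R[i]^o -> R^o) w (@continuous_coord j w); apply.
  by apply: continuous_contracting_additive; exact: le_normr_Re.
- apply: (@continuous_borel_torus (fun w => complex.Im (circle_val (w j)))) => w.
  have := @continuous_comp _ _ _ (fun w : torus R => circle_val (w j) : R[i]^o)
    (@complex.Im R : R[i]^o -> R^o) w (@continuous_coord j w); apply.
  by apply: continuous_contracting_additive; exact: le_normr_Im.
- exists 1 => w; have := circle_val_norm (w j).
  rewrite normc_def; case: (circle_val _) => x y /= [->]; exact: lexx.
Qed.

(** For nonnegative indices the product over the support, with integer exponents,
becomes a product over any initial range of coordinates that contains the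
support, with natural exponents: this is the shape of a monomial. *)
Lemma torus_char_nonneg a n w : nonneg_multi_index a ->
    (forall j, (n <= j)%N -> a j = 0) ->
  torus_char a w = \prod_(i < n) circle_val (w i) ^+ `|a i|%N.
Proof.
move=> a0 an.
have aE j : circle_val (w j) ^ a j = circle_val (w j) ^+ `|a j|%N.
  by rewrite -{1}(gez0_abs (a0 j)).
rewrite /torus_char; under eq_bigr do rewrite aE.
rewrite -(big_mkord xpredT (fun i => circle_val (w i) ^+ `|a i|%N)).
rewrite [RHS](bigID (fun i => i \in finsupp a))/= [X in _ * X]big1 ?mulr1; last first.
  by move=> i ia; rewrite fsfun_dflt// absz0 expr0.
rewrite -[RHS]big_filter; apply: perm_big.
apply: uniq_perm => [||j]; [exact: fset_uniq|by rewrite filter_uniq ?iota_uniq|].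
rewrite mem_filter mem_index_iota leq0n/=; case: (boolP (j \in finsupp a)) => //= ja.
rewrite ltnNge; apply/esym/negP => /an aj0.
by move: ja; rewrite mem_finsupp aj0 eqxx.
Qed.

Fact multi_index_of_mnm_key : unit. Proof. exact: tt. Qed.
(** Exponents are read with default 0 beyond n, so a monomial in n variables and
its padding with further variables have the same index. *)
Definition multi_index_of_mnm n (s : mpoly.multinom n) : multi_index :=
  [fsfun[multi_index_of_mnm_key] j in seq_fset tt (iota 0 n) =>
     (nth 0%N s j)%:Z | 0].

Lemma multi_index_of_mnmE n (s : mpoly.multinom n) j :
  multi_index_of_mnm s j = (nth 0%N s j)%:Z.
Proof.
rewrite fsfunE seq_fsetE mem_iota leq0n add0n/=; case: ltnP => // nj.
by rewrite nth_default// size_tuple.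
Qed.

Lemma multi_index_of_mnm_ord n (s : mpoly.multinom n) (i : 'I_n) :
  multi_index_of_mnm s i = (s i)%:Z.
Proof. by rewrite multi_index_of_mnmE (mpoly.mnm_nth 0%N). Qed.

Lemma multi_index_of_mnm_ge0 n (s : mpoly.multinom n) :
  nonneg_multi_index (multi_index_of_mnm s).
Proof. by move=> j; rewrite multi_index_of_mnmE. Qed.

Lemma torus_char_mnm n (s : mpoly.multinom n) w :
  torus_char (multi_index_of_mnm s) w = \prod_(i < n) circle_val (w i) ^+ s i.
Proof.
rewrite (torus_char_nonneg (n := n)).
- by apply: eq_bigr => i _; rewrite multi_index_of_mnm_ord.
- exact: multi_index_of_mnm_ge0.
- by move=> j nj; rewrite multi_index_of_mnmE nth_default// size_tuple.
Qed.

Lemma mnm_of_multi_index a : nonneg_multi_index a -> 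
  exists n (s : mpoly.multinom n), multi_index_of_mnm s = a.
Proof.
move=> a0; pose n := (\max_(j <- finsupp a) j).+1.
have an j : (n <= j)%N -> a j = 0.
  move=> nj; apply: fsfun_dflt; apply/negP => ja; move: nj.
  by rewrite leqNgt ltnS (@leq_bigmax_seq _ _ xpredT id j).
exists n, (mpoly.Multinom [tuple `|a i|%N | i < n]).
apply/fsfunP => j; rewrite multi_index_of_mnmE.
have [jn|nj] := ltnP j n.
  by rewrite /= (nth_mktuple (fun i : 'I_n => `|a i|%N) 0%N (Ordinal jn)) /= gez0_abs.
by rewrite nth_default ?size_tuple// an.
Qed.

(** On the circle the inverse is the conjugate. *)
Lemma torus_char_opp a w : torus_char (opp_multi_index a) w = (torus_char a w)^*.
Proof.
rewrite /torus_char rmorph_prod /=.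
have -> : finsupp (opp_multi_index a) = finsupp a.
  by apply/fsetP => j; rewrite !mem_finsupp opp_multi_indexE oppr_eq0.
apply: eq_bigr => j _; rewrite opp_multi_indexE.
have zz : circle_val (w j) * (circle_val (w j))^* = 1.
  by rewrite -sqr_normc circle_val_norm expr1n.
have z0 : circle_val (w j) != 0.
  by apply/eqP => h; move/eqP: zz; rewrite h mul0r eq_sym oner_eq0.
have -> : (circle_val (w j) ^ a j)^* = ((circle_val (w j))^*) ^ a j.
  by case: (a j) => k; rewrite /exprz/= ?conjc_inv rmorphXn.
by rewrite -exprz_inv -(mulr1 _^-1) -zz mulKf.
Qed.

Lemma bounded_mfun_mnm n (s : mpoly.multinom n) :
  bounded_mfun (fun w : borel_torus R => torus_char (multi_index_of_mnm s) w).
Proof.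
under eq_fun do rewrite torus_char_mnm.
by apply: bounded_mfun_prod => i; apply: bounded_mfunX; exact: bounded_mfun_coord.
Qed.

Lemma P0_mnm n (s : mpoly.multinom n) (c : R[i]) :
    multi_index_of_mnm s <> zero_multi_index ->
  P0 (fun w => c * torus_char (multi_index_of_mnm s) w).
Proof.
move=> s0; exists n, (c *: mpoly.mpolyX R[i] s); split.
  rewrite mpoly.mevalZ mpoly.mevalX.
  have [i si|si] := pickP (fun i => s i != 0%N).
    by rewrite (bigD1 i)//= expr0n (negbTE si) mul0r mulr0.
  exfalso; apply: s0; apply/fsfunP => j; rewrite fsfun0E.
  have [jn|nj] := ltnP j n.
    rewrite -[j]/(nat_of_ord (Ordinal jn)) multi_index_of_mnm_ord.
    by have /negbFE/eqP -> := si (Ordinal jn).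
  by rewrite multi_index_of_mnmE nth_default// size_tuple.
by apply/funext => w; rewrite /poly_torus mpoly.mevalZ mpoly.mevalX torus_char_mnm.
Qed.

Lemma poly_torusE n (q : mpoly.mpoly n R[i]) :
  poly_torus q = fun w => \sum_(s <- mpoly.msupp q)
    mpoly.mcoeff s q * torus_char (multi_index_of_mnm s) w.
Proof.
apply/funext => w; rewrite /poly_torus mpoly.mevalE; apply: eq_bigr => s _.
by rewrite torus_char_mnm.
Qed.

Lemma bounded_mfun_term n (c : R[i]) (s : mpoly.multinom n) :
  bounded_mfun (fun w : borel_torus R => c * torus_char (multi_index_of_mnm s) w).
Proof.
by apply: bounded_mfunM; [exact: bounded_mfun_cst | exact: bounded_mfun_mnm].
Qed.

Lemma bounded_mfun_poly n (q : mpoly.mpoly n R[i]) :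
  bounded_mfun (poly_torus q : borel_torus R -> R[i]).
Proof.
rewrite poly_torusE.
exact: (bounded_mfun_sum _ (fun s => bounded_mfun_term (mpoly.mcoeff s q) s)).
Qed.

(** The constant coefficient of a polynomial in P_0 vanishes, which is why only
nonzero indices contribute to its integral. *)
Lemma meval0_mcoeff n (q : mpoly.mpoly n R[i]) :
  mpoly.meval (fun=> 0) q = mpoly.mcoeff (@mpoly.mnm0 n) q.
Proof.
have E (s : mpoly.multinom n) :
    \prod_(i < n) (0 : R[i]) ^+ s i = (s == @mpoly.mnm0 n)%:R.
  have [->|/eqP s0] := eqVneq s (@mpoly.mnm0 n).
    by rewrite big1// => i _; rewrite mpoly.mnm0E expr0.
  have [i si|si] := pickP (fun i => s i != 0%N).
    by rewrite (bigD1 i)//= expr0n (negbTE si) mul0r.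
  by case: s0; apply/mpoly.mnmP => i; rewrite mpoly.mnm0E; have /negbFE/eqP := si i.
rewrite mpoly.mevalE; under eq_bigr do rewrite E.
have [q0|q0] := boolP (@mpoly.mnm0 n \in mpoly.msupp q).
  rewrite (bigD1_seq _ q0)/= ?mpoly.msupp_uniq// eqxx mulr1 big1 ?addr0// => s.
  by move=> /negbTE ->; rewrite mulr0.
move: (q0); rewrite -mpoly.mcoeff_eq0 => /eqP ->.
rewrite big_seq big1// => s sq; case: eqVneq => [E'|_]; last by rewrite mulr0.
by move: q0; rewrite -E' sq.
Qed.

End Torus.

(** * Fourier coefficients as weighted means *)

Section Fourier.
Variables (R : realType) (m : probability (borel_torus R) R).
Variable K : borel_torus R -> R.
Implicit Type a : multi_index.

(** Two conjugations coexist: the one of complex numbers over a real field and the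
one of numerically closed fields; [fourier] uses the second. *)
Lemma conj_conjc (z : R[i]) : Num.conj z = conjc z.
Proof. by []. Qed.

Lemma fourier_opp a : fourier m K (opp_multi_index a) = wmean m K (@torus_char R a).
Proof.
rewrite /fourier /Cintegral /wmean; congr (_ +i* _);
  apply: eq_Rintegral => w _; rewrite conj_conjc torus_char_opp conjcK;
  by case: (torus_char a w) => x y /=; ring.
Qed.

Lemma fourier_conj a : m.-integrable setT (EFin \o K) ->
  bounded_mfun (@torus_char R a : borel_torus R -> R[i]) ->
  fourier m K a = (fourier m K (opp_multi_index a))^*.
Proof.
move=> K_L1 ba; rewrite fourier_opp /fourier /Cintegral /wmean /=; congr (_ +i* _).
  by apply: eq_Rintegral => w _; rewrite conj_conjc; case: (torus_char a w) => x y /=; ring.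
rewrite -mulN1r -RintegralZl//; last exact: integrable_Im.
by apply: eq_Rintegral => w _; rewrite conj_conjc; case: (torus_char a w) => x y /=; ring.
Qed.

End Fourier.

(** * The extremal problem *)

Theorem theorem3p3 (R : realType) (m : probability (borel_torus R) R)
    (haar_m : is_haar m) (p : R) (p_gt1 : 1 < p)
    (K : borel_torus R -> R)
    (K_ge0 : {ae m, forall w, 0 <= K w})
    (K_L1 : m.-integrable [set: borel_torus R] (EFin \o K))
    (* [lne] is the extended-real logarithm: it is -oo where K vanishes. *)
    (logK_L1 : m.-integrable [set: borel_torus R] (fun w => lne (K w)%:E))
    (K_norm1 : ('N[m]_1[EFin \o K] = 1)%E) :
  szego_inf m p K = 1%E <->
  (forall a : multi_index, nonneg_multi_index a -> a <> zero_multi_index ->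
     fourier m K a = 0 /\ fourier m K (opp_multi_index a) = 0).
Proof.
have mK : measurable_fun setT K.
  by apply/measurable_EFinP; exact: measurable_int K_L1.
have intK1 : (\int[m]_w (K w)%:E = 1)%E.
  rewrite -K_norm1 Lnorm1; apply: ae_eq_integral => //.
  - exact/measurable_EFinP.
  - by apply: measurableT_comp => //; exact/measurable_EFinP.
  - by apply: filterS K_ge0 => w Kw _ /=; rewrite ger0_norm.
have meanK1 : \int[m]_w K w = 1 by rewrite /Rintegral intK1.
have EFin_mean (f : borel_torus R -> R[i]) : bounded_mfun f ->
    (\int[m]_w (normc (1 - f w) `^ p * K w)%:E =
     (\int[m]_w (normc (1 - f w) `^ p * K w))%R%:E)%E.
  have p0 : 0 <= p by lra.
  move=> bf; rewrite /Rintegral fineK//.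
  exact: integrable_fin_num (integrable_powR_normc K_L1 p0 (bounded_mfun_1sub bf)).
split=> [S1 a a0 az|four0].
  have [n [s sE]] := mnm_of_multi_index a0; subst a.
  set a := multi_index_of_mnm s in a0 az *.
  have ba : bounded_mfun (@torus_char R a : borel_torus R -> R[i]).
    exact: bounded_mfun_mnm.
  set z := wmean m K (@torus_char R a).
  (* z is the Fourier coefficient of K at - a. *)
  suff z0 : z = 0 by rewrite fourier_conj// fourier_opp -/z z0 conjc0.
  (* Multiplying the character by conj z turns its mean into |z|^2. *)
  have bf : bounded_mfun (fun w : borel_torus R => z^* * torus_char a w).
    by apply: bounded_mfunM => //; exact: bounded_mfun_cst.
  have : complex.Re (z^* * z) <= 0.
    rewrite -wmeanZ//; apply: (Re_mean_le0 K_L1 K_ge0 (lt_trans ltr01 p_gt1) bf).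
    move=> t t0; rewrite meanK1 -lee_fin -EFin_mean; last first.
      by apply: bounded_mfunM => //; exact: bounded_mfun_cst.
    rewrite -S1; apply: ereal_inf_lbound => /=.
    exists (fun w => (t%:C * z^*) * torus_char a w); first exact: P0_mnm.
    by apply: eq_integral => w _; rewrite mulrA.
  case: (z) => x y /= h; have x2 := sqr_ge0 x; have y2 := sqr_ge0 y.
  have /eqP : x ^+ 2 + y ^+ 2 = 0 by lra.
  by rewrite paddr_eq0// !sqrf_eq0 => /andP[/eqP -> /eqP ->].
apply/eqP; rewrite eq_le; apply/andP; split.
  apply: ereal_inf_lbound => /=; exists (fun=> 0).
    exists 0%N, 0; rewrite mpoly.meval0; split=> //.
    by apply/funext => w; rewrite /poly_torus mpoly.meval0.
  rewrite -intK1; apply: eq_integral => w _.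
  by rewrite subr0 normc1 powR1 mul1r.
apply: le_ereal_inf_tmp => _ [_ [n [q [q0 ->]] <-]].
rewrite EFin_mean; last exact: bounded_mfun_poly.
rewrite lee_fin -meanK1; apply: powR_mean_ge => //; [exact: ltW | exact: bounded_mfun_poly |].
suff -> : wmean m K (poly_torus q) = 0 by [].
rewrite poly_torusE (wmean_sum K_L1 _ (F := fun s w =>
  mpoly.mcoeff s q * torus_char (multi_index_of_mnm s) w)); last first.
  by move=> s; exact: bounded_mfun_term.
apply: big1 => s _; rewrite wmeanZ//; last exact: bounded_mfun_mnm.
have [->|/eqP s0] := eqVneq s (@mpoly.mnm0 n).
  by rewrite -meval0_mcoeff q0 mul0r.
rewrite -fourier_opp; have [||_ ->] := four0 (multi_index_of_mnm s).
- exact: multi_index_of_mnm_ge0.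
- move=> h; apply: s0; apply/mpoly.mnmP => i; rewrite mpoly.mnm0E.
  have := multi_index_of_mnm_ord s i; rewrite h fsfun0E.
  by move=> [].
- by rewrite mulr0.
Qed.
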